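(* Let $\mathcal{H}$ be a separable Hilbert space, let $\{f_n\}_{n\in\mathbb{Z}}$ be a linearly independent frame of $\mathcal{H}$ with frame-operator $S$, and let $\{h_n\}_{n\in\mathbb{Z}}=\{S^{-1}f_n\}_{n\in\mathbb{Z}}$ and $\{t_n\}_{n\in\mathbb{Z}}=\{S^{-1/2}f_n\}_{n\in\mathbb{Z}}$ be its canonical dual frame and its canonical tight frame. The following statements are equivalent. (i) $\{f_n\}_{n\in\mathbb{Z}}$ is generated by an operator in $GL(\mathcal{H})$ over $\mathbb{Z}$. (ii) $\{t_n\}_{n\in\mathbb{Z}}$ is generated by an operator in $GL(\mathcal{H})$ over $\mathbb{Z}$. (iii) $\{t_n\}_{n\in\mathbb{Z}}$ is generated by a unitary operator over $\mathbb{Z}$. (iv) $\langle t_i,t_j\rangle=\langle t_{i+1},t_{j+1}\rangle$ for all $i,j\in\mathbb{Z}$. (v) $\langle f_i,h_j\rangle=\langle f_{i+1},h_{j+1}\rangle$ for all $i,j\in\mathbb{Z}$.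
   Context: A sequence $\{f_n\}_{n\in\mathbb{Z}}$ in a (complex) separable Hilbert space $\mathcal{H}$ is a frame if there exist $A,B>0$ with $A\|f\|^2\le\sum_{n\in\mathbb{Z}}|\langle f,f_n\rangle|^2\le B\|f\|^2$ for all $f\in\mathcal{H}$. Its frame-operator is $Sf=\sum_{n\in\mathbb{Z}}\langle f,f_n\rangle f_n$, a bounded, positive, self-adjoint bijection of $\mathcal{H}$. $GL(\mathcal{H})$ is the set of bounded linear bijective operators $T:\mathcal{H}\to\mathcal{H}$ (hence with bounded inverse). A sequence $\{f_n\}_{n\in\mathbb{Z}}$ is generated over $\mathbb{Z}$ by $T\in GL(\mathcal{H})$ if $f_n=T^nf_0$ for all $n\in\mathbb{Z}$. Linear independence means that every finite subfamily is linearly independent. *)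

(* Defs.v *)
From HB Require Import structures.
From mathcomp Require Import all_boot all_order all_algebra finmap.
From mathcomp Require Export complex.
From mathcomp Require Import all_classical all_reals all_analysis.
From mathcomp.analysis.showcase Require summability.
Import Order.TTheory GRing.Theory Num.Theory.
Import numFieldNormedType.Exports.

Set Implicit Arguments.
Unset Strict Implicit.
Unset Printing Implicit Defensive.

Local Open Scope classical_set_scope.
Local Open Scope complex_scope.
Local Open Scope ring_scope.

Definition separable (T : topologicalType) : Prop :=
  exists2 D : set T, countable D & dense D.

Section Hilbert.
Context {R : realType} {H : completeNormedModType R[i]}.

(* A complex Hilbert space is a complete normed space whose norm is induced by
   an inner product; [dot] is linear in its first argument. *)
Definition induces_norm (dot : {dot H for Num.conj}) : Prop :=
  forall x : H, `|x| ^+ 2 = dot x x.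

Definition bounded_linear (T : H -> H) : Prop :=
  linear T /\ exists M : R, forall x : H, `|T x| <= M%:C * `|x|.

Definition GL (T : H -> H) : Prop := bounded_linear T /\ bijective T.

(* Only used for bijective [T], where it is the two-sided inverse. *)
Definition inverse (T : H -> H) : H -> H := 'pinv_(fun=> 0) setT T.

Definition zpow (T : H -> H) (n : int) : H -> H :=
  match n with
  | Posz k => iter k T
  | Negz k => iter k.+1 (inverse T)
  end.

Definition generated (T : H -> H) (f : int -> H) : Prop :=
  forall n : int, f n = zpow T n (f 0).

Definition lin_indep (f : int -> H) : Prop :=
  forall (A : {fset int}) (c : int -> R[i]),
    \sum_(n <- A) c n *: f n = 0 -> forall n, n \in A -> c n = 0.

Variable dot : {dot H for Num.conj}.

Definition unitary (U : H -> H) : Prop :=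
  GL U /\ forall x y : H, dot (U x) (U y) = dot x y.

(* Norms are [R[i]]-valued, hence the real parts. *)
Definition is_frame (f : int -> H) : Prop :=
  exists A B : R, [/\ 0 < A, 0 < B & forall x : H,
    ((A * complex.Re (`|x| ^+ 2))%:E
       <= \esum_(n in [set: int]) (complex.Re (`|dot x (f n)| ^+ 2))%:E)%E /\
    (\esum_(n in [set: int]) (complex.Re (`|dot x (f n)| ^+ 2))%:E
       <= (B * complex.Re (`|x| ^+ 2))%:E)%E].

(* The series is summed as a limit along the finite subsets of the index set,
   i.e. unconditionally. *)
Definition frame_operator (f : int -> H) (x : H) : H :=
  summability.sum (fun n => dot x (f n) *: f n).

Definition positive_operator (Q : H -> H) : Prop :=
  [/\ bounded_linear Q,
      forall x y : H, dot (Q x) y = dot x (Q y) &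
      forall x : H, 0 <= dot (Q x) x].

(* The positive square root of [P]: a positive bounded operator has exactly
   one; [get] returns an unspecified value when there is none. *)
Definition op_sqrt (P : H -> H) : H -> H :=
  get [set Q : H -> H | positive_operator Q /\ Q \o Q = P].

Definition canonical_dual (f : int -> H) (n : int) : H :=
  inverse (frame_operator f) (f n).

(* S^{-1/2} is read as the positive square root of S^{-1}. *)
Definition canonical_tight (f : int -> H) (n : int) : H :=
  op_sqrt (inverse (frame_operator f)) (f n).

End Hilbert.

(* Main.v *)
Require Import Defs.
From mathcomp Require Import all_boot all_order all_algebra complex.
From mathcomp Require Import all_classical all_reals all_analysis.
From mathcomp Require Import finmap ring lra.
From mathcomp.analysis.showcase Require summability.
Import Order.TTheory GRing.Theory Num.Theory.
Import numFieldNormedType.Exports.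
Local Open Scope classical_set_scope.
Local Open Scope complex_scope.
Local Open Scope ring_scope.

(** Let [S] be the frame operator and [Q] its inverse square root. The frame
    inequalities [A <= S <= B] put [S / B] within distance [sqrt (1 - A / B) < 1]
    of the identity ([frame_operator_near_id]). A contraction argument then shows
    that [S] is bijective and that it has a positive square root, which yields
    the positive operator [Q] with [Q^2 = S^-1] ([near_id_bijective],
    [near_id_inverse_sqrt]). From [Q S Q = 1] it follows that [Q] is in [GL] with
    inverse [S Q], and that the canonical tight frame [t_n = Q f_n] is Parseval:
    [x = sum_n <x, t_n> t_n] unconditionally ([canonical_tight_parseval]).

    For a bijection [T], generating a family over the integers just means
    [f_(n+1) = T f_n] ([generatedP]). Hence conjugation by [Q] exchanges the
    generators of [f] and those of [t], and self-adjointness of [Q] gives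
    [<t_i, t_j> = <f_i, h_j>], so that the shift invariance of the
    Gram matrix of [t] and that of the matrix [<f_i, h_j>] are one condition.

    What remains concerns the Parseval family [t] and its shift. If [V] in [GL]
    maps [t_n] to [t_(n+1)], reindexing shows that the shifted family is again
    Parseval, and comparing the expansions [V x = sum <x, t_n> t_(n+1)] and
    [z = sum <y, t_(n+1)> t_n] gives [<V x, y> = <x, z>] and [V z = y]: the
    adjoint of [V] inverts it, so [V] is unitary ([parseval_dot_preserving]).
    Conversely, if the Gram matrix of [t] is invariant under the shift, then
    [U x = sum <x, t_n> t_(n+1)] sends [t_k] to
    [sum <t_(k+1), t_(n+1)> t_(n+1) = t_(k+1)], and the analogous operator in the
    other direction inverts it ([parseval_gram_GL]). *)

Set Implicit Arguments.
Unset Strict Implicit.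
Unset Printing Implicit Defensive.

#[local] Existing Instance summability.totally_filter.

(** * Real-valued norms *)

Section RealNorm.
Context {R : realType}.

(** Norms over [R[i]] are complex numbers, whose order is only partial; taking
    real parts gives a total order, on which linear arithmetic applies. *)
Definition nrm (V : normedZmodType R[i]) (x : V) : R := complex.Re `|x|.

Context {V : normedZmodType R[i]}.
Implicit Types x y : V.

Lemma normE x : `|x| = (nrm x)%:C.
Proof. by rewrite RRe_real// normr_real. Qed.

Lemma nrm_ge0 x : 0 <= nrm x.
Proof. by rewrite -lecR -normE normr_ge0. Qed.

Lemma nrm0 : nrm (0 : V) = 0.
Proof. by rewrite /nrm normr0. Qed.

Lemma nrm_eq0 x : nrm x = 0 -> x = 0.
Proof. by move=> x0; apply/eqP; rewrite -normr_eq0 normE x0. Qed.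

Lemma nrmD x y : nrm (x + y) <= nrm x + nrm y.
Proof. by rewrite -lecR raddfD/= -!normE ler_normD. Qed.

Lemma nrmN x : nrm (- x) = nrm x.
Proof. by rewrite /nrm normrN. Qed.

Lemma nrm_sub x y : nrm (x - y) = nrm (y - x).
Proof. by rewrite /nrm distrC. Qed.

Lemma nrm_triangle x y z : nrm (x - z) <= nrm (x - y) + nrm (y - z).
Proof. by have := nrmD (x - y) (y - z); rewrite addrA subrK. Qed.

Lemma nrm_small x : (forall e : R, 0 < e -> nrm x <= e) -> x = 0.
Proof.
move=> x0; apply: nrm_eq0; apply/eqP; rewrite eq_le nrm_ge0 andbT.
by apply/ler_addgt0Pl => e /x0; rewrite addr0.
Qed.

End RealNorm.

Lemma nrmM {R : realType} (a b : R[i]) : nrm (a * b) = nrm a * nrm b.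
Proof. by apply: complexI; rewrite rmorphM/= -!normE normrM. Qed.

Lemma nrm_real {R : realType} (c : R) : nrm c%:C = `|c|.
Proof. by rewrite /nrm normc_def/= expr0n addr0 sqrtr_sqr. Qed.

Lemma nrm_conj {R : realType} (a : R[i]) : nrm a^* = nrm a.
Proof. by rewrite /nrm norm_conjC. Qed.

Lemma ler_Re_nrm {R : realType} (a : R[i]) : complex.Re a <= nrm a.
Proof.
by apply: le_trans (ler_norm _) _; rewrite -lecR -normE normc_ge_Re.
Qed.

Lemma sqr_nrm {R : realType} (a : R[i]) : (nrm a ^+ 2)%:C = a * a^*.
Proof. by rewrite rmorphXn/= -normE normCK. Qed.

(** * Limits and bounded operators *)

Section Convergence.
Context {R : realType} {H : completeNormedModType R[i]}.
Implicit Types x y : H.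

Lemma nrmZ (a : R[i]) x : nrm (a *: x) = nrm a * nrm x.
Proof. by apply: complexI; rewrite rmorphM/= -!normE normrZ. Qed.

Lemma cvg_nrmP {I : Type} (F : set_system I) {FF : Filter F} (u : I -> H) (l : H) :
  u @ F --> l <-> forall e : R, 0 < e -> \forall i \near F, nrm (l - u i) < e.
Proof.
split=> [ul e e0|ul].
  have e0' : 0 < e%:C by rewrite ltcR.
  move/cvgrPdist_lt: ul => /(_ _ e0').
  by apply: filterS => i; rewrite normE ltcR.
apply/cvgrPdist_lt => e e0.
have [r er] := complex_realP _ (gtr0_real e0); move: e0; rewrite {}er ltcR.
move=> /ul; apply: filterS => i.
by rewrite normE ltcR.
Qed.

Lemma cvg_nrm_unique {I : Type} (F : set_system I) {FF : ProperFilter F}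
  (u : I -> H) (l l' : H) : u @ F --> l -> u @ F --> l' -> l = l'.
Proof. by move=> ul ul'; exact: (cvg_unique _ ul ul'). Qed.

Lemma nrm_lim_le {I : Type} (F : set_system I) {FF : ProperFilter F}
    (u : I -> H) (l : H) (c : R) :
  u @ F --> l -> (\forall i \near F, nrm (u i) <= c) -> nrm l <= c.
Proof.
move=> /cvg_nrmP ul uc; apply/ler_addgt0Pl => e /ul ule.
have [i [ui lui]] := @filter_ex _ F _ _ (filterI uc ule).
have := nrm_triangle l (u i) 0; rewrite !subr0 => /le_trans; apply.
by rewrite lerD// ltW.
Qed.

(** A Cauchy criterion against a single centre [u i0], which suits both
    sequences and the net of finite partial sums. *)
Lemma complete_nrm {I : Type} (F : set_system I) {FF : ProperFilter F}
  (u : I -> H) :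
  (forall e : R, 0 < e -> exists i0, \forall i \near F, nrm (u i0 - u i) < e) ->
  exists l : H, u @ F --> l.
Proof.
move=> uC; suff : cvg (u @ F) by move=> /cvg_ex.
apply: cauchy_cvg; apply/cauchy_exP => e e0.
have [r er] := complex_realP _ (gtr0_real e0); move: e0; rewrite {}er ltcR.
move=> /uC[i0 i0F]; exists (u i0).
rewrite /nbhs/=; move: i0F; apply: filterS => i ui.
by rewrite -ball_normE/= normE ltcR.
Qed.

Lemma bounded_linearP (T : H -> H) : bounded_linear T <->
  linear T /\ exists2 M : R, 0 <= M & forall x, nrm (T x) <= M * nrm x.
Proof.
split=> [[lT [M TM]]|[lT [M M0 TM]]]; split=> //.
  exists `|M| => // x; have := TM x; rewrite !normE -rmorphM lecR => /le_trans.
  by apply; rewrite ler_wpM2r ?nrm_ge0// ler_norm.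
by exists M => x; rewrite !normE -rmorphM lecR.
Qed.

Section Linear.
Variables (T : H -> H) (lT : linear T).

Lemma linD x y : T (x + y) = T x + T y.
Proof. by have := lT 1 x y; rewrite !scale1r. Qed.

Lemma lin0 : T 0 = 0.
Proof. by have := linD 0 0; rewrite addr0 => /eqP; rewrite addrC -subr_eq subrr => /eqP. Qed.

Lemma linZ a x : T (a *: x) = a *: T x.
Proof. by have := lT a x 0; rewrite !addr0 lin0 addr0. Qed.

Lemma linB x y : T (x - y) = T x - T y.
Proof. by rewrite -scaleN1r linD linZ scaleN1r. Qed.

Lemma lin_sum {I : Type} (r : seq I) (u : I -> H) :
  T (\sum_(i <- r) u i) = \sum_(i <- r) T (u i).
Proof. exact: (big_morph T linD lin0). Qed.

End Linear.

Lemma linear_comp (T U : H -> H) : linear T -> linear U -> linear (T \o U).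
Proof. by move=> lT lU a x y /=; rewrite lU lT. Qed.

Lemma bounded_linear_comp (T U : H -> H) :
  bounded_linear T -> bounded_linear U -> bounded_linear (T \o U).
Proof.
move=> /bounded_linearP[lT [M M0 TM]] /bounded_linearP[lU [N N0 UN]].
apply/bounded_linearP; split; first exact: linear_comp.
exists (M * N); first exact: mulr_ge0.
move=> x /=; apply: le_trans (TM _) _; rewrite -mulrA ler_wpM2l//.
Qed.

Lemma bounded_linear_id : bounded_linear (@idfun H).
Proof. by apply/bounded_linearP; split=> //; exists 1 => // x; rewrite mul1r. Qed.

Lemma bounded_linear_scale (a : R[i]) : bounded_linear (fun x : H => a *: x).
Proof.
apply/bounded_linearP; split.
  by move=> b x y; rewrite scalerDr !scalerA mulrC.
by exists (nrm a) => [|x]; rewrite ?nrm_ge0 ?nrmZ.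
Qed.

Lemma bounded_linear_cvg {I : Type} (F : set_system I) {FF : Filter F} (T : H -> H)
    (u : I -> H) (l : H) :
  bounded_linear T -> u @ F --> l -> (T \o u) @ F --> T l.
Proof.
move=> /bounded_linearP[lT [M M0 TM]] /cvg_nrmP ul; apply/cvg_nrmP => e e0.
have M1 : 0 < M + 1 by rewrite ltr_wpDl.
have := ul (e / (M + 1)); rewrite divr_gt0// => /(_ isT); apply: filterS => i.
rewrite ltr_pdivlMr// /= -linB// => ui; apply: le_lt_trans (TM _) _.
apply: le_lt_trans ui; rewrite mulrDr mulr1 mulrC lerDl nrm_ge0//.
Qed.

Lemma inverseK (T : H -> H) : bijective T ->
  cancel T (inverse T) /\ cancel (inverse T) T.
Proof.
move=> bT; split=> x.
  by rewrite /inverse pinvKV ?in_setT// => ? ? _ _; exact: bij_inj.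
rewrite /inverse pinvK//; have [U _ UT] := bT.
by apply/mem_set; exists (U x).
Qed.

Lemma inverse_linear (T : H -> H) : bijective T -> linear T -> linear (inverse T).
Proof.
move=> bT lT a x y; have [_ TK] := inverseK bT; apply: (bij_inj bT).
by rewrite TK lT !TK.
Qed.

(** The tail from [n] on is dominated by a geometric sum, hence by
    [C * b ^+ n / (1 - b)], which tends to zero. *)
Lemma geometric_cvg (u : nat -> H) (C b : R) : 0 <= C -> 0 <= b < 1 ->
    (forall n, nrm (u n.+1 - u n) <= C * b ^+ n) ->
  exists l : H, u @ \oo --> l.
Proof.
move=> C0 /andP[b0 b1] uC.
have b1' : 0 < 1 - b by rewrite subr_gt0.
have tail n k : nrm (u (n + k)%N - u n) <= C * b ^+ n / (1 - b) * (1 - b ^+ k).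
  elim: k => [|k IH]; first by rewrite addn0 subrr nrm0 expr0 subrr mulr0.
  apply: le_trans (nrm_triangle _ (u (n + k)%N) _) _.
  have := uC (n + k)%N; rewrite -addnS => uk.
  (* One more term of the geometric sum. *)
  have -> : C * b ^+ n / (1 - b) * (1 - b ^+ k.+1) =
    C * b ^+ (n + k) + C * b ^+ n / (1 - b) * (1 - b ^+ k).
    by rewrite exprD exprS; field; rewrite gt_eqF.
  by rewrite addnS lerD// -addnS.
apply: (@complete_nrm _ \oo _ u) => e e0.
have D0 : 0 <= C / (1 - b) by rewrite divr_ge0// ltW.
have D1 : 0 < C / (1 - b) + 1 by rewrite ltr_wpDl.
have /cvgrPdist_lt/(_ (e / (C / (1 - b) + 1))) : (GRing.exp b @ \oo --> (0 : R)).
  by apply: cvg_expr; rewrite ger0_norm.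
rewrite divr_gt0// => /(_ isT) [n0 _ /(_ n0 (leqnn _))]/=.
rewrite sub0r normrN ger0_norm ?exprn_ge0// ltr_pdivlMr// => bn.
exists n0; exists n0 => // m /= nm.
rewrite -(subnKC nm) nrm_sub; apply: le_lt_trans (tail _ _) _.
apply: le_lt_trans bn; rewrite (mulrAC C).
apply: (@le_trans _ _ (C / (1 - b) * b ^+ n0)).
  apply: ler_piMr; last by rewrite gerBl exprn_ge0.
  by apply: mulr_ge0 => //; exact: exprn_ge0.
by rewrite mulrDr mulr1 mulrC lerDl exprn_ge0.
Qed.

End Convergence.

(** * Inner products and their limits *)

Section InnerProduct.
Context {R : realType} {H : completeNormedModType R[i]}.
Variable dot : {dot H for Num.conj}.
Hypothesis dot_norm : induces_norm dot.
Implicit Types x y z : H.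

Lemma dotC x y : dot x y = (dot y x)^*.
Proof. by rewrite hermC expr0 mul1r. Qed.

Lemma dotDl x y z : dot (x + y) z = dot x z + dot y z.
Proof. exact: linearDl. Qed.

Lemma dotBl x y z : dot (x - y) z = dot x z - dot y z.
Proof. exact: linearBl. Qed.

Lemma dotZl a x y : dot (a *: x) y = a * dot x y.
Proof. exact: linearZl_LR. Qed.

Lemma dotDr x y z : dot z (x + y) = dot z x + dot z y.
Proof. exact: linearDr. Qed.

Lemma dotBr x y z : dot z (x - y) = dot z x - dot z y.
Proof. exact: linearBr. Qed.

Lemma dotZr a x y : dot y (a *: x) = a^* * dot y x.
Proof. exact: linearZr_LR. Qed.

Lemma dot_suml {I : Type} (r : seq I) (u : I -> H) y :
  dot (\sum_(i <- r) u i) y = \sum_(i <- r) dot (u i) y.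
Proof. exact: linear_sumlz. Qed.

Lemma dot_sumr {I : Type} (r : seq I) (u : I -> H) y :
  dot y (\sum_(i <- r) u i) = \sum_(i <- r) dot y (u i).
Proof. exact: linear_sumr. Qed.

Definition rdot x y : R := complex.Re (dot x y).

Lemma rdotC x y : rdot x y = rdot y x.
Proof. by rewrite /rdot dotC; case: (dot y x). Qed.

Lemma rdotDl x y z : rdot (x + y) z = rdot x z + rdot y z.
Proof. by rewrite /rdot dotDl raddfD. Qed.

Lemma rdotBl x y z : rdot (x - y) z = rdot x z - rdot y z.
Proof. by rewrite /rdot dotBl raddfB. Qed.

Lemma rdotZl (c : R) x y : rdot (c%:C *: x) y = c * rdot x y.
Proof. by rewrite /rdot dotZl; case: (dot x y) => a b /=; rewrite mul0r subr0. Qed.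

Lemma dotxx x : dot x x = (nrm x ^+ 2)%:C.
Proof. by rewrite -dot_norm normE rmorphXn. Qed.

Lemma rdotxx x : rdot x x = nrm x ^+ 2.
Proof. by rewrite /rdot dotxx. Qed.

Lemma sqr_nrmB x y : nrm (x - y) ^+ 2 = nrm x ^+ 2 - 2 * rdot x y + nrm y ^+ 2.
Proof.
rewrite -!rdotxx rdotBl !(rdotC _ (x - y)) !rdotBl (rdotC y x); ring.
Qed.

(** The norm of the component of [x] orthogonal to [y] is nonnegative; its
    square is the difference of the squared sides, divided by [nrm y ^+ 2]. *)
Lemma cauchy_schwarz x y : nrm (dot x y) <= nrm x * nrm y.
Proof.
have [y0|y0] := eqVneq (nrm y) 0.
  by rewrite (nrm_eq0 y0) linear0r !nrm0 mulr0.
have yy0 : 0 < nrm y ^+ 2 by rewrite exprn_gt0// lt_def y0 nrm_ge0.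
rewrite -ler_sqr ?nnegrE ?mulr_ge0 ?nrm_ge0// exprMn -ler_pdivrMr// -subr_ge0.
set c : R := (nrm y ^+ 2)^-1.
suff -> : nrm x ^+ 2 - nrm (dot x y) ^+ 2 * c =
  nrm (x - (dot x y * c%:C) *: y) ^+ 2 by rewrite exprn_ge0// nrm_ge0.
rewrite sqr_nrmB nrmZ nrmM nrm_real ger0_norm ?invr_ge0 ?exprn_ge0 ?nrm_ge0//.
have -> : rdot x ((dot x y * c%:C) *: y) = nrm (dot x y) ^+ 2 * c.
  have cC : (c%:C)^* = c%:C by apply: conj_Creal; apply/complex_realP; eexists.
  by rewrite /rdot dotZr rmorphM/= cC mulrAC (mulrC (_^*)) -sqr_nrm -rmorphM.
by rewrite /c; field.
Qed.

Lemma ler_rdot x y : rdot x y <= nrm x * nrm y.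
Proof. exact: le_trans (ler_Re_nrm _) (cauchy_schwarz _ _). Qed.

Section Limits.
Context {I : Type} (F : set_system I) {FF : ProperFilter F}.
Implicit Types (u v : I -> H) (l m : H).

Lemma rdot_lim_le u l y (c : R) : u @ F --> l ->
  (\forall i \near F, rdot (u i) y <= c) -> rdot l y <= c.
Proof.
move=> /cvg_nrmP ul uc; apply/ler_addgt0Pl => e e0.
have y1 : 0 < nrm y + 1 by rewrite ltr_wpDl ?nrm_ge0.
have := ul (e / (nrm y + 1)); rewrite divr_gt0// => /(_ isT) ule.
have [i [ui lui]] := @filter_ex _ F _ _ (filterI uc ule).
rewrite -(subrK (u i) l) rdotDl lerD// (le_trans (ler_rdot _ _))//.
move: lui; rewrite ltr_pdivlMr// => /ltW; apply: le_trans.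
by rewrite ler_wpM2l ?nrm_ge0// lerDl.
Qed.

Lemma rdot_lim_ge u l y (c : R) : u @ F --> l ->
  (\forall i \near F, c <= rdot (u i) y) -> c <= rdot l y.
Proof.
move=> ul cu.
have rN z : rdot z ((-1)%:C *: y) = - rdot z y by rewrite rdotC rdotZl mulN1r rdotC.
rewrite -lerN2 -rN; apply: rdot_lim_le ul _.
by apply: filterS cu => i; rewrite rN lerN2.
Qed.

(** An adjunction identity that holds along a net survives in the limit;
    this is how limit operators are seen to be self-adjoint or unitary below. *)
Lemma dot_lim_eq u v l m x y : u @ F --> l -> v @ F --> m ->
  (forall i, dot (u i) y = dot x (v i)) -> dot l y = dot x m.
Proof.
move=> /cvg_nrmP ul /cvg_nrmP vm uv; apply/eqP; rewrite -subr_eq0; apply/eqP.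
apply: nrm_small => e e0.
have d0 : 0 < nrm x + nrm y + 1 by rewrite ltr_wpDl// addr_ge0 ?nrm_ge0.
have e0' : 0 < e / (nrm x + nrm y + 1) by rewrite divr_gt0.
have [i [ui vi]] := @filter_ex _ F _ _ (filterI (ul _ e0') (vm _ e0')).
have -> : dot l y - dot x m = dot (l - u i) y - dot x (m - v i).
  by rewrite dotBl dotBr uv opprB addrA subrK.
apply: le_trans (nrmD _ _) _; rewrite nrmN.
apply: le_trans (lerD (cauchy_schwarz _ _) (cauchy_schwarz _ _)) _.
move: ui vi; rewrite !ltr_pdivlMr//.
have := nrm_ge0 x; have := nrm_ge0 y; have := nrm_ge0 (l - u i).
have := nrm_ge0 (m - v i).
move: (nrm x) (nrm y) (nrm (l - _)) (nrm (m - _)) => a b c d; clear.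
set s := a + b + 1 => d0 c0 b0 a0 cs ds.
have sE : s = a + b + 1 by [].
have s0 : 0 < s by rewrite sE; lra.
(* Both distances are below [e / s], so the larger one times [s] is below [e]. *)
have [cd|/ltW cd] := leP c d.
  apply: (@le_trans _ _ (d * s)); last exact: ltW.
  rewrite sE; nra.
apply: (@le_trans _ _ (c * s)); last exact: ltW.
rewrite sE; nra.
Qed.

End Limits.
End InnerProduct.

(** * Square roots of operators close to the identity *)

Section SquareRoot.
Context {R : realType} {H : completeNormedModType R[i]}.
Variable dot : {dot H for Num.conj}.
Hypothesis dot_norm : induces_norm dot.
Implicit Types x y z : H.

Definition self_adjoint (T : H -> H) := forall x y, dot (T x) y = dot x (T y).

Lemma self_adjoint_dot (T : H -> H) x :
  self_adjoint T -> dot (T x) x = (rdot dot (T x) x)%:C.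
Proof.
move=> saT; rewrite RRe_real//; apply/CrealP.
by rewrite -dotC saT.
Qed.

(** From here on [P] is an operator such that [c P] lies within distance [b < 1]
    of the identity, which turns both its inversion and the extraction of its
    square root into contraction problems. *)
Variables (P : H -> H) (c b : R).
Hypotheses (linP : linear P) (c_gt0 : 0 < c) (b01 : 0 <= b < 1).
Hypothesis P_near_id : forall x, nrm (x - c%:C *: P x) <= b * nrm x.

Let b0 : 0 <= b. Proof. by case/andP: b01. Qed.
Let b1 : b < 1. Proof. by case/andP: b01. Qed.

Definition defect x := x - c%:C *: P x.

Lemma linear_defect : linear defect.
Proof.
move=> a x y; rewrite /defect linP scalerDr scalerA mulrC -scalerA.
by rewrite opprD addrACA scalerBr.
Qed.

Lemma defect_bounded : bounded_linear defect.
Proof. by apply/bounded_linearP; split; [exact: linear_defect|exists b]. Qed.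

Lemma near_id_lower_bound x : (1 - b) * nrm x <= c * nrm (P x).
Proof.
have := nrm_triangle x (c%:C *: P x) 0; rewrite !subr0 nrmZ nrm_real gtr0_norm//.
by have := P_near_id x; lra.
Qed.

(** [c P l = y] says that [l] is a fixed point of [l |-> y + defect l], and this
    map contracts distances by [b]. *)
Lemma near_id_bijective : bijective P.
Proof.
have Psurj y : exists x, P x = y.
  pose u n := iter n (fun x => y + defect x) 0.
  have uS n : u n.+1 = y + defect (u n) by [].
  have uC n : nrm (u n.+1 - u n) <= nrm y * b ^+ n.
    elim: n => [|n IH].
      by rewrite /u/= /defect (lin0 linP) scaler0 !subr0 addr0 expr0 mulr1.
    rewrite uS [X in nrm (_ - X)]uS opprD addrACA subrr add0r -(linB linear_defect).
    rewrite exprS mulrCA; apply: le_trans (P_near_id _) _.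
    by rewrite ler_wpM2l.
  have [l ul] := geometric_cvg (nrm_ge0 y) b01 uC.
  have ul' : (u n.+1 @[n --> \oo] --> y + defect l).
    apply: cvgD; first exact: cvg_cst.
    exact: (bounded_linear_cvg defect_bounded ul).
  have : (u n.+1 @[n --> \oo] --> l) by move: ul; rewrite -(cvg_shiftS u).
  move=> /(cvg_nrm_unique ul')/eqP.
  rewrite /defect addrA (addrC y) -addrA -subr_eq0 addrAC subrr add0r subr_eq0.
  move=> /eqP ->; exists (c%:C *: l); rewrite (linZ linP)//.
have [g gP] := choice Psurj; exists g => // x.
apply/eqP; rewrite -subr_eq0; apply/eqP/nrm_eq0/eqP.
rewrite eq_le nrm_ge0 andbT -(pmulr_rle0 _ (_ : 0 < 1 - b)) ?subr_gt0//.
apply: le_trans (near_id_lower_bound _) _.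
by rewrite (linB linP) gP subrr nrm0 mulr0.
Qed.

Lemma near_id_inverse_bounded : bounded_linear (inverse P).
Proof.
have [_ PK] := inverseK near_id_bijective.
apply/bounded_linearP; split; first exact: (inverse_linear near_id_bijective).
have b1' : 0 < 1 - b by rewrite subr_gt0.
exists (c / (1 - b)); first by rewrite divr_ge0// ltW.
move=> x; rewrite mulrAC ler_pdivlMr// mulrC.
by have := near_id_lower_bound (inverse P x); rewrite PK.
Qed.

Hypothesis saP : self_adjoint P.

(** With [D] the defect, [1 - Y] is a square root of [c P = 1 - D] exactly when
    [Y = (D + Y^2) / 2]; this is the fixed point iteration for that equation,
    started at zero. It stays in the ball of radius [b], on which it contracts by
    [b]. *)
Fixpoint sqrt_iter n x : H :=
  if n is n'.+1 then 2^-1 *: (defect x + sqrt_iter n' (sqrt_iter n' x)) else 0.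

Lemma linear_sqrt_iter n : linear (sqrt_iter n).
Proof.
elim: n => [|n IH] a x y /=; first by rewrite scaler0 addr0.
rewrite linear_defect !IH addrACA -scalerDr [LHS]scalerDr !scalerA.
by rewrite (mulrC a).
Qed.

Let nrm_half : nrm (2^-1 : R[i]) = 2^-1 :> R.
Proof. by rewrite -(rmorph_nat (real_complex R)) -fmorphV nrm_real ger0_norm. Qed.

Lemma sqrt_iter_bound n x : nrm (sqrt_iter n x) <= b * nrm x.
Proof.
elim: n x => [|n IH] x /=; first by rewrite nrm0 mulr_ge0// nrm_ge0.
rewrite nrmZ nrm_half mulrC ler_pdivrMr// mulr_natr mulr2n.
apply: le_trans (nrmD _ _) _; rewrite lerD ?P_near_id//.
apply: le_trans (IH _) _; apply: ler_wpM2l => //.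
apply: le_trans (IH _) _; rewrite ler_piMl ?nrm_ge0//; exact: ltW.
Qed.

Lemma sqrt_iterB n x :
  nrm (sqrt_iter n.+1 x - sqrt_iter n x) <= nrm x * b * b ^+ n.
Proof.
elim: n x => [|n IH] x.
  rewrite /= addr0 subr0 expr0 mulr1 nrmZ nrm_half mulrC ler_pdivrMr//.
  apply: le_trans (P_near_id _) _; rewrite mulrC.
  have := mulr_ge0 (nrm_ge0 x) b0; lra.
(* For operators, [Y^2 - Z^2 = Y (Y - Z) + (Y - Z) Z]. *)
set Y := sqrt_iter n.+1; set Z := sqrt_iter n.
have -> : sqrt_iter n.+2 x - Y x = 2^-1 *: (Y (Y x - Z x) + (Y (Z x) - Z (Z x))).
  have -> : Y (Y x - Z x) = Y (Y x) - Y (Z x) by exact: (linB (linear_sqrt_iter _)).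
  rewrite addrA subrK.
  by rewrite {2}/Y /= -scalerBr opprD addrACA subrr add0r.
rewrite nrmZ nrm_half mulrC ler_pdivrMr// mulr_natr mulr2n.
apply: le_trans (nrmD _ _) _; apply: lerD.
  apply: le_trans (sqrt_iter_bound _ _) _; rewrite exprS mulrCA.
  by rewrite ler_wpM2l// IH.
apply: le_trans (IH _) _.
have -> : nrm x * b * b ^+ n.+1 = b * nrm x * b * b ^+ n by rewrite exprS; ring.
by rewrite !ler_wpM2r ?exprn_ge0// sqrt_iter_bound.
Qed.

Lemma sqrt_iter_self_adjoint n : self_adjoint (sqrt_iter n).
Proof.
elim: n => [|n IH] x y /=; first by rewrite linear0l linear0r.
have h2 : (2^-1 : R[i])^* = 2^-1 by rewrite fmorphV rmorph_nat.
rewrite dotZl dotZr h2 dotDl dotDr !IH /defect dotBl dotBr dotZl dotZr.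
by rewrite saP (conj_Creal (_ : c%:C \is Num.real))//; apply/complex_realP; exists c.
Qed.

(** The limit [Y] of the iteration satisfies [nrm (Y x) <= b * nrm x] and is
    self-adjoint, hence [1 - Y] is positive and squares to [c P]; dividing by the
    square root of [c] gives the root of [P]. *)
Lemma near_id_sqrt : exists W, positive_operator dot W /\ W \o W = P.
Proof.
have Ycvg x : exists y, sqrt_iter ^~ x @ \oo --> y.
  have C0 := mulr_ge0 (nrm_ge0 x) b0.
  exact: (geometric_cvg (u := sqrt_iter ^~ x) C0 b01 (sqrt_iterB ^~ x)).
have [Y Yx] := choice Ycvg.
have Ylin : linear Y.
  move=> a x y; apply: (cvg_nrm_unique (Yx _)).
  under eq_fun do rewrite linear_sqrt_iter.
  by apply: cvgD (Yx y); apply: cvgZl_tmp; exact: Yx.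
have Yb x : nrm (Y x) <= b * nrm x.
  by apply: (nrm_lim_le (Yx x)); near=> n; exact: sqrt_iter_bound.
have Ysa : self_adjoint Y.
  by move=> x y; apply: (dot_lim_eq dot_norm (Yx x) (Yx y)) => n; exact: sqrt_iter_self_adjoint.
have YE x : Y x = 2^-1 *: (defect x + Y (Y x)).
  apply: (cvg_nrm_unique (u := fun n => sqrt_iter n.+1 x) (F := \oo)).
    by have := Yx x; rewrite -(cvg_shiftS).
  apply: cvgZl_tmp; apply: cvgD; first exact: cvg_cst.
  apply/cvg_nrmP => e e0; have e2 : 0 < e / 2 by rewrite divr_gt0.
  have /cvg_nrmP/(_ _ e2) Y1 := Yx (Y x); have /cvg_nrmP/(_ _ e2) Y2 := Yx x.
  near=> n; have Y3 : nrm (Y (Y x) - sqrt_iter n (Y x)) < e / 2 by near: n.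
  have Y4 : nrm (Y x - sqrt_iter n x) < e / 2 by near: n.
  apply: le_lt_trans (nrm_triangle _ (sqrt_iter n (Y x)) _) _.
  rewrite [e]splitr ltrD// -(linB (linear_sqrt_iter _)).
  apply: le_lt_trans Y4; apply: le_trans (sqrt_iter_bound _ _) _.
  by rewrite ler_piMl ?nrm_ge0// ltW.
pose W0 x := x - Y x.
have W0lin : linear W0.
  by move=> a x y; rewrite /W0 Ylin opprD addrACA scalerBr.
have W0sq x : W0 (W0 x) = c%:C *: P x.
  have Y2 : Y x + Y x = defect x + Y (Y x).
    by rewrite [in LHS]YE -scalerDl (_ : 2^-1 + 2^-1 = 1) ?scale1r//; field.
  rewrite /W0 (linB Ylin).
  have -> : x - Y x - (Y x - Y (Y x)) = x - (Y x + Y x) + Y (Y x).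
    by rewrite opprB opprD !addrA addrAC.
  by rewrite Y2 opprD addrA subrK subKr.
pose s := Num.sqrt c^-1.
have s0 : 0 <= s by exact: sqrtr_ge0.
have ss : s * s = c^-1 by rewrite -expr2 sqr_sqrtr// invr_ge0 ltW.
exists (fun x => s%:C *: W0 x); split; last first.
  apply/funext => x /=; rewrite (linZ W0lin) W0sq !scalerA -!rmorphM.
  by rewrite ss mulVf ?scale1r// gt_eqF.
have Wsa : self_adjoint (fun x => s%:C *: W0 x).
  move=> x y; rewrite dotZl dotZr /W0 dotBl dotBr Ysa.
  by rewrite (conj_Creal (_ : s%:C \is Num.real))//; apply/complex_realP; exists s.
split=> //.
- apply/bounded_linearP; split.
    by move=> a x y; rewrite W0lin scalerDr !scalerA mulrC.
  exists (s * (1 + b)); first by rewrite mulr_ge0// addr_ge0.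
  move=> x; rewrite nrmZ nrm_real ger0_norm// -mulrA ler_wpM2l// mulrDl mul1r.
  by apply: le_trans (nrmD _ _) _; rewrite nrmN lerD.
- move=> x; rewrite (self_adjoint_dot _ Wsa) ler0c rdotZl mulr_ge0//.
  rewrite rdotBl rdotxx// subr_ge0; apply: le_trans (ler_rdot dot_norm _ _) _.
  by rewrite expr2 ler_wpM2r ?nrm_ge0// (le_trans (Yb x))// ler_piMl ?nrm_ge0// ltW.
Unshelve. all: by end_near.
Qed.

(** If [W] is a positive root of [P] then [W P^-1] is a positive root of [P^-1].
    Existence alone makes [op_sqrt] choose an operator with these properties. *)
Lemma near_id_inverse_sqrt :
  let Q := op_sqrt dot (inverse P) in
  positive_operator dot Q /\ Q \o Q = inverse P.
Proof.
have [PK KP] := inverseK near_id_bijective.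
suff /getPex : exists Q, [set Q | positive_operator dot Q /\ Q \o Q = inverse P] Q.
  by [].
have [W [[bW saW posW] WW]] := near_id_sqrt.
have WQ x : W ((W \o inverse P) x) = x by rewrite /= -[LHS]/((W \o W) _) WW KP.
exists (W \o inverse P); split; first split.
- exact: bounded_linear_comp bW near_id_inverse_bounded.
- move=> x y; rewrite -[y in LHS]WQ -saW WQ; exact: erefl.
- by move=> x; rewrite -[x in X in _ <= dot _ X]WQ -saW.
- apply/funext => x; apply: (can_inj PK); rewrite KP -{1}WW.
  by rewrite -[LHS]/(W (W ((W \o inverse P) ((W \o inverse P) x)))) !WQ.
Qed.
End SquareRoot.

(** * Unconditional sums *)

Section UnconditionalSums.
Context {R : realType} {H : completeNormedModType R[i]} {I : choiceType}.
Implicit Types (u : I -> H) (x : H) (A : {fset I}).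

(** [u] sums to [x] unconditionally: along the directed set of finite subsets. *)
Definition usum_to u x := summability.partial_sum u @ summability.totally --> x.

Lemma near_totally (P : {fset I} -> Prop) :
  (\forall A \near summability.totally, P A) <->
  exists A0, forall A, (A0 `<=` A)%fset -> P A.
Proof.
by split=> [[A0 _ A0P]|[A0 A0P]]; exists A0.
Qed.

Lemma partial_sumE u A : summability.partial_sum u A = \sum_(i <- A) u i.
Proof. by rewrite /summability.partial_sum big_seq_fsetE. Qed.

Lemma fset_sum_split (V : nmodType) (u : I -> V) (A0 A : {fset I}) : (A0 `<=` A)%fset ->
  \sum_(i <- A) u i = \sum_(i <- A0) u i + \sum_(i <- (A `\` A0)%fset) u i.
Proof.
move=> A0A; rewrite (big_fsetID _ (mem A0))/=; congr (_ + _); apply: eq_fbigl => i.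
  by rewrite !inE/=; have /fsubsetP/(_ i) := A0A; case: (i \in A0) => [->|]; rewrite ?andbF.
by rewrite !inE/= andbC.
Qed.

Lemma usum_toP u x : usum_to u x <->
  forall e : R, 0 < e -> exists A0, forall A, (A0 `<=` A)%fset ->
    nrm (x - \sum_(i <- A) u i) < e.
Proof.
split=> [/cvg_nrmP ux e /ux /near_totally[A0 A0P]|ux].
  by exists A0 => A /A0P; rewrite partial_sumE.
apply/cvg_nrmP => e /ux[A0 A0P]; apply/near_totally; exists A0 => A /A0P.
by rewrite partial_sumE.
Qed.

(** Two partial sums over sets that contain [A0] differ by sums outside [A0]. *)
Lemma usum_cauchy u :
  (forall e : R, 0 < e -> exists A0, forall A, (A0 `<=` A)%fset ->
    nrm (\sum_(i <- (A `\` A0)%fset) u i) < e) ->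
  exists x, usum_to u x.
Proof.
move=> uC; apply: complete_nrm => e /uC[A0 A0P]; exists A0; apply/near_totally.
exists A0 => A A0A; rewrite !partial_sumE (fset_sum_split _ A0A).
by rewrite opprD addNKr nrmN A0P.
Qed.

Lemma usum_unique u x y : usum_to u x -> usum_to u y -> x = y.
Proof. exact: cvg_nrm_unique. Qed.

Lemma usum_sum u x : usum_to u x -> summability.sum u = x.
Proof. by move=> ux; apply: cvg_lim ux; exact: norm_hausdorff. Qed.

Lemma usum_linear (T : H -> H) u x : bounded_linear T -> usum_to u x ->
  usum_to (T \o u) (T x).
Proof.
move=> bT /(bounded_linear_cvg bT); rewrite /usum_to.
have -> : summability.partial_sum (T \o u) = T \o summability.partial_sum u.
  by apply/funext => A; rewrite /= !partial_sumE lin_sum//; case: bT.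
by [].
Qed.

Lemma usumD u v x y : usum_to u x -> usum_to v y ->
  usum_to (fun i => u i + v i) (x + y).
Proof.
move=> ux vy; rewrite /usum_to.
have -> : summability.partial_sum (fun i => u i + v i) =
  summability.partial_sum u + summability.partial_sum v.
  by apply/funext => A; rewrite partial_sumE big_split/= -!partial_sumE.
exact: cvgD ux vy.
Qed.

Lemma usum_reindex (s : I -> I) u x : bijective s -> usum_to u x ->
  usum_to (u \o s) x.
Proof.
move=> [t st ts] /usum_toP ux; apply/usum_toP => e /ux[A0 A0P].
exists [fset t i | i in A0]%fset => A A0A.
have -> : \sum_(i <- A) (u \o s) i = \sum_(i <- [fset s i | i in A]%fset) u i.
  by rewrite big_imfset//= => i j _ _; exact: can_inj st _ _.
apply: A0P; apply/fsubsetP => i iA0; apply/imfsetP; exists (t i); last by rewrite ts.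
by apply: (fsubsetP A0A); apply/imfsetP; exists i.
Qed.

End UnconditionalSums.
Arguments usum_sum {R H I u x}.

(** * Bessel families *)

Section Frames.
Context {R : realType} {H : completeNormedModType R[i]} {I : choiceType}.
Variable dot : {dot H for Num.conj}.
Hypothesis dot_norm : induces_norm dot.
Implicit Types (f p q : I -> H) (x y : H) (A : {fset I}).

Definition bessel f (B : R) := forall x A,
  \sum_(n <- A) nrm (dot x (f n)) ^+ 2 <= B * nrm x ^+ 2.

Section Bessel.
Variables (f : I -> H) (B : R).
Hypotheses (B_gt0 : 0 < B) (fB : bessel f B).

(** Termwise, [a b <= (B a^2 + b^2 / B) / 2]; the Bessel inequality bounds the
    sum of the second squares by [nrm y ^+ 2]. The unequal weights are chosen so
    that taking [y] to be the sum itself absorbs the last term on the left. *)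
Lemma bessel_rdot (c : I -> R[i]) y A :
  rdot dot (\sum_(n <- A) c n *: f n) y <=
    (B * (\sum_(n <- A) nrm (c n) ^+ 2) + nrm y ^+ 2) / 2.
Proof.
apply: (@le_trans _ _ (\sum_(n <- A)
    (B * nrm (c n) ^+ 2 + B^-1 * nrm (dot y (f n)) ^+ 2) / 2)).
  rewrite /rdot dot_suml raddf_sum/=; apply: ler_sum => n _.
  rewrite dotZl; apply: le_trans (ler_Re_nrm _) _.
  rewrite nrmM dotC nrm_conj; set a := nrm (c n); set b := nrm _.
  rewrite -subr_ge0.
  have -> : (B * a ^+ 2 + B^-1 * b ^+ 2) / 2 - a * b = B^-1 * (B * a - b) ^+ 2 / 2.
    by field; rewrite gt_eqF.
  by rewrite divr_ge0// mulr_ge0// ?sqr_ge0// invr_ge0 ltW.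
rewrite -mulr_suml big_split/= -!mulr_sumr ler_wpM2r// lerD2l.
by rewrite mulrC ler_pdivrMr// mulrC fB.
Qed.

Lemma bessel_synthesis (c : I -> R[i]) A :
  nrm (\sum_(n <- A) c n *: f n) ^+ 2 <= B * (\sum_(n <- A) nrm (c n) ^+ 2).
Proof.
set y := \sum_(n <- A) _.
have := bessel_rdot c y A; rewrite -/y rdotxx//; lra.
Qed.

(** Synthesis converges for square-summable coefficients: outside a finite set
    that nearly exhausts the supremum of their finite square sums, the remaining
    square sums are small, and synthesis is bounded by them. *)
Lemma bessel_usum (c : I -> R[i]) (C : R) :
    (forall A, \sum_(n <- A) nrm (c n) ^+ 2 <= C) ->
  exists2 y, usum_to (fun n => c n *: f n) y & nrm y <= Num.sqrt (B * C).
Proof.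
move=> cC; suff [y cy] : exists y, usum_to (fun n => c n *: f n) y.
  exists y => //; apply: (nrm_lim_le cy); apply: nearW => A.
  rewrite partial_sumE -[leLHS]ger0_norm ?nrm_ge0// -sqrtr_sqr ler_wsqrtr//.
  apply: le_trans (bessel_synthesis _ _) _; rewrite ler_wpM2l//; exact: ltW.
apply: usum_cauchy => e e0.
pose r n := nrm (c n) ^+ 2.
pose E : set R := [set \sum_(n <- A) r n | A in [set: {fset I}]].
have supE : has_sup E.
  split; first by exists (\sum_(n <- fset0) r n), fset0.
  by exists C => _ [A _ <-]; exact: cC.
have d0 : 0 < e ^+ 2 / B by rewrite divr_gt0// exprn_gt0.
have [_ [A0 _ <-] A0E] := sup_adherent d0 supE.
exists A0 => A A0A; rewrite -ltr_sqr ?nnegrE ?nrm_ge0// ?ltW//.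
apply: le_lt_trans (bessel_synthesis _ _) _; rewrite mulrC -ltr_pdivlMr//.
have /(sup_upper_bound supE) : E (\sum_(n <- A) r n) by exists A.
by rewrite (fset_sum_split _ A0A); move: A0E; rewrite /r; lra.
Qed.

Lemma bessel_usum_self_adjoint x y Sx Sy :
  usum_to (fun n => dot x (f n) *: f n) Sx ->
  usum_to (fun n => dot y (f n) *: f n) Sy -> dot Sx y = dot x Sy.
Proof.
move=> xS yS; apply: (dot_lim_eq dot_norm xS yS) => A.
rewrite !partial_sumE dot_suml dot_sumr; apply: eq_bigr => n _.
by rewrite dotZl dotZr (dotC dot (f n)) mulrC -dotC.
Qed.

Lemma bessel_usum_ge x y A : usum_to (fun n => dot x (f n) *: f n) y ->
  \sum_(n <- A) nrm (dot x (f n)) ^+ 2 <= rdot dot y x.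
Proof.
move=> xy; apply: (rdot_lim_ge dot_norm xy); apply/near_totally; exists A => A' AA'.
rewrite partial_sumE /rdot dot_suml raddf_sum/=.
have -> : \sum_(n <- A') complex.Re (dot (dot x (f n) *: f n) x) =
    \sum_(n <- A') nrm (dot x (f n)) ^+ 2.
  by apply: eq_bigr => n _; rewrite dotZl (dotC dot (f n)) -sqr_nrm.
rewrite (fset_sum_split _ AA') lerDl; apply: sumr_ge0 => n _; exact: sqr_ge0.
Qed.

(** The inequality [S^2 <= B S] for the frame operator [S], which is sharper than
    boundedness and gives the contraction estimate below. *)
Lemma bessel_usum_sqr_le x y : usum_to (fun n => dot x (f n) *: f n) y ->
  nrm y ^+ 2 <= B * rdot dot y x.
Proof.
move=> xy; have : rdot dot y y <= (B * rdot dot y x + nrm y ^+ 2) / 2.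
  apply: (rdot_lim_le dot_norm xy); apply: nearW => A; rewrite partial_sumE.
  apply: le_trans (bessel_rdot _ _ _) _; rewrite ler_wpM2r// lerD2r.
  by apply: ler_wpM2l; [exact: ltW|exact: bessel_usum_ge].
rewrite rdotxx//; lra.
Qed.

End Bessel.
End Frames.

(** * The frame operator *)

Section FrameOperator.
Context {R : realType} {H : completeNormedModType R[i]}.
Variable dot : {dot H for Num.conj}.
Hypothesis dot_norm : induces_norm dot.
Implicit Types (x y : H).

Lemma ReX2_norm (V : normedZmodType R[i]) (x : V) :
  complex.Re (`|x| ^+ 2) = nrm x ^+ 2.
Proof. by rewrite normE -rmorphXn. Qed.

Lemma ler_fset_esum {I : choiceType} (r : I -> R) (A : {fset I}) :
  ((\sum_(n <- A) r n)%:E <= \esum_(n in [set: I]) (r n)%:E)%E.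
Proof.
apply: esum_ge; exists [set` A]; first by split.
by rewrite fsbig_finite//= set_fsetK sumEFin.
Qed.

Lemma esum_fset_le {I : choiceType} (r : I -> R) (c : R) :
  (forall A : {fset I}, \sum_(n <- A) r n <= c) ->
  (\esum_(n in [set: I]) (r n)%:E <= c%:E)%E.
Proof.
move=> rc; apply: ge_ereal_sup => _ [X [finX _] <-].
by rewrite fsbig_finite//= sumEFin lee_fin.
Qed.

Variable f : int -> H.

(** The frame inequalities in terms of finite sums only. The lower one says that
    [A * nrm x ^+ 2] is below every upper bound of the finite sums, as the
    extended sum is their supremum. *)
Lemma is_frameP : is_frame dot f -> exists A B : R, [/\ 0 < A, 0 < B,
  bessel dot f B & forall x (c : R),
    (forall D : {fset int}, \sum_(n <- D) nrm (dot x (f n)) ^+ 2 <= c) ->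
    A * nrm x ^+ 2 <= c].
Proof.
move=> [A [B [A0 B0 AB]]]; exists A, B; split=> // [x D|x c xc];
  have [] := AB x; rewrite !ReX2_norm; under eq_esum do rewrite ReX2_norm.
- move=> _ xB; rewrite -lee_fin; apply: le_trans xB.
  exact: (ler_fset_esum (fun n => nrm (dot x (f n)) ^+ 2)).
- move=> Ax _; rewrite -lee_fin; apply: le_trans Ax _.
  exact: esum_fset_le.
Qed.

Let S := frame_operator dot f.

Section BesselOperator.
Variable B : R.
Hypotheses (B_gt0 : 0 < B) (fB : bessel dot f B).

Lemma frame_operator_usum x : usum_to (fun n => dot x (f n) *: f n) (S x).
Proof.
have [y xy _] := bessel_usum dot_norm B_gt0 fB (fB x).
by rewrite /S /frame_operator (usum_sum xy).
Qed.

Lemma frame_operator_linear : linear S.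
Proof.
move=> a x y; apply: (usum_unique (@frame_operator_usum _)).
have -> : (fun n => dot (a *: x + y) (f n) *: f n) =
    (fun n => a *: (dot x (f n) *: f n) + dot y (f n) *: f n).
  by apply/funext => n; rewrite dotDl dotZl scalerDl scalerA.
exact: usumD (usum_linear (bounded_linear_scale a) (@frame_operator_usum x)) (@frame_operator_usum y).
Qed.

Lemma frame_operator_self_adjoint : self_adjoint dot S.
Proof.
move=> x y.
by apply: (bessel_usum_self_adjoint dot_norm (f := f)); exact: frame_operator_usum.
Qed.

(** Expanding the square, [|x - S x / B|^2 = |x|^2 - 2 <S x, x> / B + |S x|^2 / B^2]
    is at most [|x|^2 - <S x, x> / B] because [|S x|^2 <= B <S x, x>], and
    [<S x, x> >= A |x|^2]. *)
Lemma frame_operator_near_id (A : R) :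
    (forall x (c : R),
      (forall D : {fset int}, \sum_(n <- D) nrm (dot x (f n)) ^+ 2 <= c) ->
      A * nrm x ^+ 2 <= c) ->
  forall x, nrm (x - (B^-1)%:C *: S x) <= Num.sqrt (1 - A / B) * nrm x.
Proof.
move=> fA x.
have lo : A * nrm x ^+ 2 <= rdot dot (S x) x.
  apply: fA => D; exact: (bessel_usum_ge dot_norm D (@frame_operator_usum x)).
have hi := bessel_usum_sqr_le dot_norm B_gt0 fB (@frame_operator_usum x).
rewrite -[leLHS]ger0_norm ?nrm_ge0// -sqrtr_sqr.
rewrite -[X in _ * X]ger0_norm ?nrm_ge0// -[X in _ * X]sqrtr_sqr.
rewrite [leRHS]mulrC -sqrtrM ?sqr_ge0//; apply: ler_wsqrtr; rewrite (sqr_nrmB dot_norm) nrmZ.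
have Bi : 0 <= B^-1 by rewrite invr_ge0 ltW.
rewrite nrm_real ger0_norm// rdotC rdotZl exprMn.
rewrite -subr_ge0.
set X := nrm x ^+ 2 in lo *; set Y := nrm (S x) ^+ 2 in hi *; set r := rdot _ _ _ in lo hi *.
have -> : X * (1 - A / B) - (X - 2 * (B^-1 * r) + B^-1 ^+ 2 * Y) =
    B^-1 * (r - A * X) + B^-1 ^+ 2 * (B * r - Y) by field; rewrite gt_eqF.
by rewrite addr_ge0// mulr_ge0 ?exprn_ge0 ?subr_ge0.
Qed.

End BesselOperator.
End FrameOperator.

Section CanonicalTight.
Context {R : realType} {H : completeNormedModType R[i]}.
Variable dot : {dot H for Num.conj}.
Hypothesis dot_norm : induces_norm dot.
Implicit Types (x y : H).

Variable f : int -> H.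
Hypothesis f_frame : is_frame dot f.

Lemma inverse_frame_operator_sqrt :
  let S := frame_operator dot f in let Q := op_sqrt dot (inverse S) in
  [/\ bounded_linear S, bijective S, positive_operator dot Q & Q \o Q = inverse S].
Proof.
have [A [B [A0 B0 fB fA]]] := is_frameP f_frame.
pose b := Num.sqrt (1 - A / B).
have b01 : 0 <= b < 1.
  rewrite sqrtr_ge0/= -[ltRHS]sqrtr1 ltr_sqrt// gtrBl divr_gt0//.
have linS := frame_operator_linear dot_norm B0 fB.
have saS := frame_operator_self_adjoint dot_norm B0 fB.
have Bi : 0 < B^-1 by rewrite invr_gt0.
have nearS := frame_operator_near_id dot_norm B0 fB fA.
have [posQ QQ] := near_id_inverse_sqrt dot_norm linS Bi b01 nearS saS.
move=> S Q; split=> //; last exact: (near_id_bijective linS Bi b01 nearS).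
apply/bounded_linearP; split=> //; exists (B * (1 + b)).
  by rewrite mulr_ge0 ?addr_ge0 ?sqrtr_ge0// ltW.
move=> x; rewrite -mulrA -ler_pdivrMl//.
have := nrm_triangle ((B^-1)%:C *: S x) x 0.
rewrite !subr0 nrmZ nrm_real gtr0_norm// nrm_sub => /le_trans; apply.
by rewrite mulrDl mul1r addrC lerD2l nearS.
Qed.

End CanonicalTight.

(** * Generation over the integers *)

Section GeneralLinear.
Context {R : realType} {H : completeNormedModType R[i]}.
Implicit Types (T U : H -> H) (x : H).

Lemma GL_comp T U : GL T -> GL U -> GL (T \o U).
Proof.
by move=> [bT T1] [bU U1]; split; [exact: bounded_linear_comp|exact: bij_comp].
Qed.

(** Powers of the inverse disappear from the problem: for a bijection, being an
    orbit over all integers is a one-step recursion. *)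
Lemma generatedP T (f : int -> H) : bijective T ->
  generated T f <-> forall n, f (n + 1) = T (f n).
Proof.
move=> bT; have [TK KT] := inverseK bT.
have PoszS k : Posz k + 1 = Posz k.+1 by rewrite -PoszD addn1.
have NegzS k : Negz k.+1 + 1 = Negz k by rewrite !NegzE -[k.+2]addn1 PoszD opprD subrK.
have Negz0 : Negz 0 + 1 = 0 by rewrite NegzE addNr.
split=> [fT|fT].
  case=> [k|[|k]].
  - by rewrite PoszS fT [in RHS]fT.
  - by rewrite Negz0 [in RHS]fT /= KT.
  - by rewrite NegzS fT [in RHS]fT /= KT.
case=> n; elim: n => [|n IH] //.
- by rewrite -[in LHS]PoszS fT IH.
- by apply: (bij_inj bT); rewrite -fT Negz0 /= KT.
- by apply: (bij_inj bT); rewrite -fT NegzS IH /= KT.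
Qed.

End GeneralLinear.

(** * Parseval families *)

Section Parseval.
Context {R : realType} {H : completeNormedModType R[i]} {I : choiceType}.
Variable dot : {dot H for Num.conj}.
Hypothesis dot_norm : induces_norm dot.
Implicit Types (p q : I -> H) (x y : H).

(** A tight frame of bound one, expressed by its reconstruction formula. *)
Definition parseval p := forall x, usum_to (fun n => dot x (p n) *: p n) x.

Lemma parseval_bessel p : parseval p -> bessel dot p 1.
Proof.
move=> pp x A; rewrite mul1r -(rdotxx dot_norm).
exact: (bessel_usum_ge dot_norm A (pp x)).
Qed.

Lemma parseval_reindex p (s : I -> I) : bijective s -> parseval p ->
  parseval (p \o s).
Proof. by move=> bs pp x; exact: usum_reindex bs (pp x). Qed.

Lemma parseval_ext p (T U : H -> H) : parseval p ->
  bounded_linear T -> bounded_linear U -> (forall n, T (p n) = U (p n)) -> T = U.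
Proof.
move=> pp bT bU TU; apply/funext => x.
apply: usum_unique (usum_linear bT (pp x)) _.
have -> : T \o (fun n => dot x (p n) *: p n) = U \o (fun n => dot x (p n) *: p n).
  by apply/funext => n /=; rewrite (linZ bT.1) (linZ bU.1) TU.
exact: usum_linear bU (pp x).
Qed.

(** Analysis along one Parseval family followed by synthesis along another is a
    contraction. *)
Lemma parseval_mixed p q x : parseval p -> parseval q ->
  exists2 y, usum_to (fun n => dot x (p n) *: q n) y & nrm y <= nrm x.
Proof.
move=> /parseval_bessel pB /parseval_bessel qB.
have [] := bessel_usum dot_norm ltr01 qB (pB x) => y xy yx; exists y => //.
by move: yx; rewrite !mul1r sqrtr_sqr ger0_norm ?nrm_ge0.
Qed.

(** The adjoint of [V] is the mixed operator [y |-> sum <y, q_n> p_n], by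
    comparison with [V x = sum <x, p_n> q_n]. It is a right inverse of [V] since
    [V] sends [p_n] to [q_n] and [q] reconstructs; [V] being injective, it is the
    inverse of [V]. *)
Lemma parseval_dot_preserving p q (V : H -> H) : parseval p -> parseval q ->
  GL V -> (forall n, V (p n) = q n) -> forall x y, dot (V x) (V y) = dot x y.
Proof.
move=> pp qp [bV bijV] Vp x y.
have [z yz _] := parseval_mixed (V y) qp pp.
have Vz : V z = V y.
  apply: usum_unique (usum_linear bV yz) _.
  have -> // : V \o (fun n => dot (V y) (q n) *: p n) =
    (fun n => dot (V y) (q n) *: q n).
  by apply/funext => n /=; rewrite (linZ bV.1) Vp.
rewrite -[in RHS](bij_inj bijV Vz).
apply: (dot_lim_eq dot_norm (usum_linear bV (pp x)) yz) => A.
rewrite !partial_sumE dot_suml dot_sumr; apply: eq_bigr => n _ /=.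
by rewrite (linZ bV.1) dotZl dotZr Vp -dotC mulrC.
Qed.

(** Take [U x = sum <x, p_n> q_n]. At [p_k] its coefficients are [<p_k, p_n>], that
    is [<q_k, q_n>], so the sum reconstructs [q_k]. *)
Lemma parseval_gram_transfer p q : parseval p -> parseval q ->
    (forall i j, dot (p i) (p j) = dot (q i) (q j)) ->
  exists2 U : H -> H, bounded_linear U & forall n, U (p n) = q n.
Proof.
move=> pp qp pq.
have /choice[U UP] : forall x, exists y,
    usum_to (fun n => dot x (p n) *: q n) y /\ nrm y <= nrm x.
  by move=> x; have [y] := parseval_mixed x pp qp; exists y.
exists U.
  apply/bounded_linearP; split; last by exists 1 => // x; rewrite mul1r (UP x).2.
  move=> a x y; apply: usum_unique (UP _).1 _.
  have -> : (fun n => dot (a *: x + y) (p n) *: q n) =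
      (fun n => a *: (dot x (p n) *: q n) + dot y (p n) *: q n).
    by apply/funext => n; rewrite dotDl dotZl scalerDl scalerA.
  exact: usumD (usum_linear (bounded_linear_scale a) (UP x).1) (UP y).1.
move=> n; apply: usum_unique (UP _).1 _.
by under eq_fun do rewrite pq; exact: qp.
Qed.

(** The operators obtained in the two directions are mutually inverse on the two
    families, hence everywhere, by density in the form of [parseval_ext]. *)
Lemma parseval_gram_GL p q : parseval p -> parseval q ->
    (forall i j, dot (p i) (p j) = dot (q i) (q j)) ->
  exists2 U : H -> H, GL U & forall n, U (p n) = q n.
Proof.
move=> pp qp pq; have [U bU Upq] := parseval_gram_transfer pp qp pq.
have [V bV Vqp] := parseval_gram_transfer qp pp (fun i j => esym (pq i j)).
exists U => //; split=> //.
have UV : U \o V = idfun.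
  apply: (parseval_ext qp (bounded_linear_comp bU bV) bounded_linear_id) => n.
  by rewrite /= Vqp Upq.
have VU : V \o U = idfun.
  apply: (parseval_ext pp (bounded_linear_comp bV bU) bounded_linear_id) => n.
  by rewrite /= Upq Vqp.
by exists V => x; [rewrite -[LHS]/((V \o U) x) VU|rewrite -[LHS]/((U \o V) x) UV].
Qed.

End Parseval.

(** * The canonical tight frame *)

Section CanonicalTightParseval.
Context {R : realType} {H : completeNormedModType R[i]}.
Variable dot : {dot H for Num.conj}.
Hypothesis dot_norm : induces_norm dot.
Variable f : int -> H.
Hypothesis f_frame : is_frame dot f.

Let S := frame_operator dot f.
Let Q := op_sqrt dot (inverse S).

(** [Q] commutes with [S] because [Q^2 S = 1 = S Q^2]; stated as [Q S Q = 1], it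
    identifies the inverse of [Q] as [S Q], which is visibly bounded. *)
Lemma inverse_sqrt_conj x : Q (S (Q x)) = x.
Proof.
have [_ bS _ QQ] := inverse_frame_operator_sqrt dot_norm f_frame.
have [SK KS] := inverseK bS.
have QQE y : Q (Q y) = inverse S y by rewrite -[LHS]/((Q \o Q) y) QQ.
have Qinj : injective Q.
  by apply: inj_compr (Q) _ _; rewrite QQ; exact: can_inj KS.
by apply: Qinj; rewrite QQE SK.
Qed.

Lemma inverse_sqrt_GL : GL Q /\ GL (S \o Q).
Proof.
have [bS bijS [bQ _ _] QQ] := inverse_frame_operator_sqrt dot_norm f_frame.
have bijQ : bijective Q.
  exists (S \o Q) => x /=; last exact: inverse_sqrt_conj.
  by rewrite -[Q (Q x)]/((Q \o Q) x) QQ; exact: (inverseK bijS).2.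
have GQ : GL Q by [].
by split=> //; apply: GL_comp.
Qed.

(** Apply [Q] to the expansion of [S (Q x)] and move [Q] to the other side of the
    inner products. *)
Lemma canonical_tight_parseval : parseval dot (canonical_tight dot f).
Proof.
have [A [B [_ B0 fB _]]] := is_frameP f_frame.
have [_ _ [bQ saQ _] _] := inverse_frame_operator_sqrt dot_norm f_frame.
rewrite -/S -/Q in bQ saQ; move=> x; rewrite -[X in usum_to _ X]inverse_sqrt_conj.
have := usum_linear bQ (@frame_operator_usum _ _ _ dot_norm _ _ B0 fB (Q x)).
have -> // : Q \o (fun n => dot (Q x) (f n) *: f n) =
  (fun n => dot x (canonical_tight dot f n) *: canonical_tight dot f n).
by apply/funext => n /=; rewrite saQ -/S -/Q (linZ bQ.1).
Qed.

(** [<Q f_i, Q f_j> = <f_i, Q^2 f_j>], and [Q^2] is the inverse of [S]. *)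
Lemma canonical_tight_dot i j :
  dot (canonical_tight dot f i) (canonical_tight dot f j) =
  dot (f i) (canonical_dual dot f j).
Proof.
have [_ _ [_ saQ _] QQ] := inverse_frame_operator_sqrt dot_norm f_frame.
by rewrite /canonical_dual -QQ saQ.
Qed.

End CanonicalTightParseval.

(** * The equivalences *)

Theorem theorem2p6 (R : realType) (H : completeNormedModType R[i])
    (dot : {dot H for Num.conj}) (dot_norm : induces_norm dot)
    (H_separable : separable H)
    (f : int -> H) (f_frame : is_frame dot f) (f_indep : lin_indep f) :
  let h := canonical_dual dot f in
  let t := canonical_tight dot f in
  [<-> (exists2 T : H -> H, GL T & generated T f);
       (exists2 T : H -> H, GL T & generated T t);
       (exists2 U : H -> H, unitary dot U & generated U t);
       (forall i j : int, dot (t i) (t j) = dot (t (i + 1)) (t (j + 1)));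
       (forall i j : int, dot (f i) (h j) = dot (f (i + 1)) (h (j + 1)))].
Proof.
move=> h t.
have tp : parseval dot t := canonical_tight_parseval dot_norm f_frame.
have bij_succ : bijective (fun n : int => n + 1).
  by exists (fun n => n - 1) => n; rewrite ?addrK ?subrK.
have tp1 := parseval_reindex bij_succ tp.
have [GQ GSQ] := inverse_sqrt_GL dot_norm f_frame.
have QSQ := inverse_sqrt_conj dot_norm f_frame.
set Q := op_sqrt _ _ in GQ GSQ QSQ; set SQ := _ \o Q in GSQ.
have tE n : t n = Q (f n) by [].
have SQK x : SQ (Q x) = x by apply: (bij_inj GQ.2); rewrite QSQ.
tfae.
- move=> [T GT]; rewrite generatedP; last exact: GT.2.
  move=> fT; have GV := GL_comp GQ (GL_comp GT GSQ).
  exists (Q \o (T \o SQ)) => //; rewrite generatedP; last exact: GV.2.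
  by move=> n; rewrite !tE fT /= SQK.
- move=> [V GV tV]; exists V => //; split=> //; move: tV.
  rewrite generatedP; last exact: GV.2.
  by move=> tV; apply: (parseval_dot_preserving dot_norm tp tp1 GV) => n; rewrite /= tV.
- move=> [U [GU dotU]]; rewrite generatedP; last exact: GU.2.
  by move=> tU i j; rewrite !tU dotU.
- by move=> tt i j; rewrite -!(canonical_tight_dot dot_norm f_frame).
- move=> fh.
  have tt i j : dot (t i) (t j) = dot ((t \o (fun n => n + 1)) i) ((t \o (fun n => n + 1)) j).
    by rewrite /= !(canonical_tight_dot dot_norm f_frame).
  have [U GU tU] := parseval_gram_GL dot_norm tp tp1 tt.
  have GT := GL_comp GSQ (GL_comp GU GQ); exists (SQ \o (U \o Q)) => //.
  by rewrite generatedP; [move=> n; rewrite /= -tE tU /= tE SQK|exact: GT.2].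
Qed.
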